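(* Let $i,k,\ell$ be integers with $k\ge 1$, $\ell\ge 0$ and $0\le i\le k$. Then, for $|q|<1$, $$\frac{1}{(q^{i+1},q^{2k-i},q^{2k+1};q^{2k+1})_\infty}\sum_{j=-\ell}^{\ell-1}(-1)^j q^{(k+\frac12)j^2+(k-i-\frac12)j}$$ $$=1+\frac{(-1)^{\ell-1}q^{(k+\frac12)(\ell^2+\ell)-(i+1)\ell}\,(q)_\infty}{(q^{i+1},q^{2k-i},q^{2k+1};q^{2k+1})_\infty}\sum_{n_1,n_2,\ldots,n_k\ge 0}\frac{(q^{2\ell+1})^{N_1+N_2+\cdots+N_k}\,q^{N_1^2+N_2^2+\cdots+N_k^2-N_1-N_2-\cdots-N_i}\,(1-q^\ell)}{(q)_{n_1}(q)_{n_2}\cdots(q)_{n_{k-1}}(q)_{n_k}(q)_{n_k+2\ell}\,(1-q^{\ell+n_k})},$$ where $N_j=n_j+n_{j+1}+\cdots+n_k$ for $1\le j\le k$.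
   Context: Here $(a)_n=(a;q)_n=\prod_{m=0}^{n-1}(1-aq^m)$ (with $(a;q)_0=1$), $(a)_\infty=(a;q)_\infty=\prod_{m\ge 0}(1-aq^m)$, and $(a_1,\ldots,a_r;p)_\infty=\prod_{s=1}^r(a_s;p)_\infty$. When $i=0$ the term $-N_1-\cdots-N_i$ is absent. When $\ell=0$ the sum $\sum_{j=-\ell}^{\ell-1}$ is empty (equal to $0$), and the quotient $(1-q^\ell)/(1-q^{\ell+n_k})$ is interpreted as $1$ if $n_k=0$ and $0$ if $n_k>0$. *)

(* Defs.v *)
From mathcomp Require Import all_boot all_order all_algebra.
From mathcomp Require Import all_classical all_reals all_analysis.
From mathcomp Require Import complex ring lra zify.
From mathcomp.analysis.showcase Require Import summability.

Set Implicit Arguments.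
Unset Strict Implicit.
Unset Printing Implicit Defensive.

Import Order.TTheory GRing.Theory Num.Theory.
Import numFieldNormedType.Exports.

Local Open Scope classical_set_scope.
Local Open Scope ring_scope.

(* (a; q)_n *)
Definition qpoch (A : comPzRingType) (a q : A) (n : nat) : A :=
  \prod_(m < n) (1 - a * q ^+ m).

(* (a; q)_oo, the field R[i] carrying the topology of its modulus through the
   alias R[i]^o *)
Definition qpoch_inf (R : realType) (a q : R[i]) : R[i] :=
  limn (fun n => qpoch a q n : R[i]^o).

(* (a_1, ..., a_r; p)_oo with as_ = [:: a_1; ...; a_r] *)
Definition qpoch_infs (R : realType) (as_ : seq R[i]) (p : R[i]) : R[i] :=
  \prod_(a <- as_) qpoch_inf a p.

(* (k + 1/2) j^2 + (k - i - 1/2) j; the numerator is always even, see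
   theta_expE *)
Definition theta_exp (k i : nat) (j : int) : int :=
  (((2 * k%:Z + 1) * j ^+ 2 + (2 * k%:Z - 2 * i%:Z - 1) * j) %/ 2)%Z.

(* (k + 1/2) (l^2 + l) - (i + 1) l; the division is exact, see prefactor_expE *)
Definition prefactor_exp (k i l : nat) : int :=
  (((2 * k%:Z + 1) * (l%:Z ^+ 2 + l%:Z)) %/ 2)%Z - (i%:Z + 1) * l%:Z.

(* The components are numbered from 1: n = [tuple n_1; ...; n_k]. *)
Definition entry (k : nat) (n : k.-tuple nat) (j : nat) : nat := nth 0%N n j.-1.

(* N_j = n_j + n_(j+1) + ... + n_k, for 1 <= j <= k *)
Definition tail_sum (k : nat) (n : k.-tuple nat) (j : nat) : nat :=
  (\sum_(j <= m < k.+1) entry n m)%N.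

(* N_1^2 + ... + N_k^2 - N_1 - ... - N_i *)
Definition quad_exp (k i : nat) (n : k.-tuple nat) : int :=
  (\sum_(1 <= j < k.+1) tail_sum n j ^ 2)%N%:Z
  - (\sum_(1 <= j < i.+1) tail_sum n j)%N%:Z.

(* (1 - q^l) / (1 - q^(l + m)), read as 1 if l = m = 0 and as 0 if l = 0 < m *)
Definition ratio (F : fieldType) (q : F) (l m : nat) : F :=
  if l == 0%N then (m == 0%N)%:R else (1 - q ^+ l) / (1 - q ^+ (l + m)).

Definition summand (F : fieldType) (q : F) (k i l : nat) (n : k.-tuple nat) : F :=
  (q ^+ (2 * l + 1)) ^+ (\sum_(1 <= j < k.+1) tail_sum n j)%N
  * q ^ quad_exp i n
  / (\prod_(1 <= j < k.+1) qpoch q q (entry n j)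
     * qpoch q q (entry n k + 2 * l))
  * ratio q l (entry n k).

(* Sum over all n_1, ..., n_k >= 0: limit of the finite partial sums along the
   directed set of finite subsets of nat^k. *)
Definition multisum (R : realType) (k : nat) (f : k.-tuple nat -> R[i]) : R[i] :=
  summability.sum (f : k.-tuple nat -> R[i]^o).

Lemma sqrz_parity (j : int) : exists m : int, j ^+ 2 = j + 2 * m.
Proof.
have e := divz_eq j 2.
have h0 : (0 <= (j %% 2)%Z) by apply: modz_ge0.
have h1 : ((j %% 2)%Z < 2) by apply: ltz_pmod.
set d := (j %/ 2)%Z in e *; set r := (j %% 2)%Z in e h0 h1 *.
have [r0|r1] : r = 0 \/ r = 1 by lia.
- by exists (2 * d ^+ 2 - d); rewrite e r0; ring.
- by exists (2 * d ^+ 2 + d); rewrite e r1; ring.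
Qed.

Lemma theta_expE (k i : nat) (j : int) :
  (theta_exp k i j)%:~R =
  (k%:R + 1 / 2) * j%:~R ^+ 2 + (k%:R - i%:R - 1 / 2) * j%:~R :> rat.
Proof.
have [m jm] := sqrz_parity j.
have -> : theta_exp k i j = k%:Z * j ^+ 2 + (k%:Z - i%:Z) * j + m.
  rewrite /theta_exp (_ : _ + _ = (k%:Z * j ^+ 2 + (k%:Z - i%:Z) * j + m) * 2).
    by rewrite mulzK.
  by rewrite mulrDl mul1r {2}jm; ring.
have jmQ : j%:~R ^+ 2 = j%:~R + 2 * m%:~R :> rat.
  by rewrite -rmorphXn /= jm rmorphD rmorphM.
rewrite !(rmorphD, rmorphM, rmorphB, rmorphXn) /=.
have -> : m%:~R = (j%:~R ^+ 2 - j%:~R) / 2 :> rat by rewrite jmQ; field.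
by rewrite !pmulrn; field.
Qed.

Lemma prefactor_expE (k i l : nat) :
  (prefactor_exp k i l)%:~R =
  (k%:R + 1 / 2) * (l%:R ^+ 2 + l%:R) - (i%:R + 1) * l%:R :> rat.
Proof.
have [m lm] := sqrz_parity l%:Z.
have -> : prefactor_exp k i l =
    (2 * k%:Z + 1) * (l%:Z + m) - (i%:Z + 1) * l%:Z.
  rewrite /prefactor_exp.
  rewrite (_ : _ * (_ + _) = (2 * k%:Z + 1) * (l%:Z + m) * 2); last first.
    by rewrite lm; ring.
  by rewrite mulzK.
have lmQ : l%:R ^+ 2 = l%:R + 2 * m%:~R :> rat.
  by rewrite !pmulrn -rmorphXn /= lm rmorphD rmorphM.
rewrite !(rmorphD, rmorphM, rmorphB) /= -!pmulrn lmQ.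
by field.
Qed.

(* Main.v *)
Require Import Defs.
From mathcomp Require Import all_boot all_order all_algebra.
From mathcomp Require Import all_classical all_reals all_analysis.
From mathcomp Require Import complex.
From mathcomp Require Import finmap ring lra zify.
From mathcomp.analysis.showcase Require Import summability.

(**
Put w_j = (-1)^j q^(theta(j)), where theta(j) = (k + 1/2) j^2 + (k - i - 1/2) j,
and let S be the multiple sum.  The power of q in front of S is q^(theta(l)),
so after multiplication by D the identity reads

  (-1)^l q^(theta(l)) (q)_oo S = D - sum_(-l <= j < l) w_j.

By Jacobi's triple product in base q^(2k+1), D is the sum of w_j over all
integers j; hence the claim is that S sums the two tails j >= l and j < -l.

The tails come out of S by a Bailey lattice.  With N_0 = L, the factors
1/(q)_(N_(j-1) - N_j) make S a chain of k nested sums; nest keeps the factor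
1/(q)_(L - N_1) that S itself lacks, which is harmless as it tends to
1/(q)_oo.  A sequence of the form
  G(N) = sum_r alpha_r / ((q)_(N-r) (q)_(N+r+e))
keeps that form under one more nested sum with weight q^(M^2 + e M), each
alpha_r being multiplied by q^(r^2 + e r): this is bailey_chain, an instance
of the q-Chu-Vandermonde sum q_vandermonde.  The innermost factor has this
form with e = 2l+1 (seed_pair, a telescoping sum).  The k-i inner sums, whose
weights have e = 2l+1, are treated first; bailey_lower then rewrites the result
with e = 2l, each kernel splitting into two neighbours; and the i outer sums
have e = 2l.  The two neighbours carry exactly w_(l+r) and w_(-l-r-1), so that
signed_nest expresses (-1)^l q^(theta(l)) nest(L) as
  sum_r w_j / ((q)_(L+l-j) (q)_(L+l+j))
over the j of the two tails with j = l+r or j = -l-r-1.  The limit L -> oo, by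
dominated convergence, gives (tails)/(q)_oo^2 on one side and S/(q)_oo on the
other.

The triple product is proved by the same passage to the limit from its finite
form, an induction on the two truncation orders.  The terms w_j with j < 0 are
written with a second variable y, x y = p, in place of p/x, so that q = 0 is
not exceptional; the case l = 0 (the Andrews-Gordon identities) is also covered
by the same argument.
*)

Set Implicit Arguments.
Unset Strict Implicit.
Unset Printing Implicit Defensive.

Import Order.TTheory GRing.Theory Num.Theory.
Import numFieldNormedType.Exports.
Import Normc.

Local Open Scope classical_set_scope.
Local Open Scope ring_scope.

(** * The modulus of a complex number *)

Section Modulus.
Variable R : rcfType.
Implicit Types x y : R[i].

Lemma normr_normc x : `|x| = (normc x)%:C%C. Proof. by []. Qed.

Lemma normc_ge0 x : 0 <= normc x. Proof. by case: x => a b; exact: sqrtr_ge0. Qed.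

Lemma normc_exp x n : normc (x ^+ n) = normc x ^+ n.
Proof. by apply: complexI; rewrite rmorphXn -!normr_normc normrX. Qed.

Lemma normc_sign n : normc ((-1) ^+ n : R[i]) = 1.
Proof. by rewrite normc_exp normcN normc1 expr1n. Qed.

Lemma normc_sum (I : Type) (s : seq I) (P : pred I) (F : I -> R[i]) :
  normc (\sum_(j <- s | P j) F j) <= \sum_(j <- s | P j) normc (F j).
Proof.
rewrite -lecR rmorph_sum -normr_normc; apply: le_trans (ler_norm_sum _ _ _) _.
by apply: ler_sum.
Qed.

Lemma normc_prod (I : Type) (s : seq I) (P : pred I) (F : I -> R[i]) :
  normc (\prod_(j <- s | P j) F j) = \prod_(j <- s | P j) normc (F j).
Proof. by apply: complexI; rewrite rmorph_prod -normr_normc normr_prod. Qed.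

Lemma normc_sub_ge x y : normc x - normc y <= normc (x - y).
Proof. by have := le_normcD (x - y) y; rewrite subrK; lra. Qed.

Lemma Re_le_normc x : `|complex.Re x| <= normc x.
Proof. by rewrite -lecR -normr_normc normc_ge_Re. Qed.

Lemma Im_le_normc x : `|complex.Im x| <= normc x.
Proof.
have := Re_le_normc (x * 'i%C); rewrite ReiNIm normrN normcM.
suff -> : normc ('i%C : R[i]) = 1 by rewrite mulr1.
by rewrite /normc /= expr0n expr1n add0r sqrtr1.
Qed.

Lemma normc_le_ReIm x : normc x <= `|complex.Re x| + `|complex.Im x|.
Proof.
rewrite {1}[x]complexE; apply: le_trans (le_normcD _ _) _; rewrite normcM.
have -> : normc ('i%C : R[i]) = 1 by rewrite /normc /= expr0n expr1n add0r sqrtr1.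
by rewrite /normc /= !expr0n !addr0 !sqrtr_sqr mul1r.
Qed.

End Modulus.

(** * Limits of sequences *)

Section Tendsto.
Variable K : numFieldType.
Implicit Types (u v : nat -> K) (a b : K).

(** Convergence for the topology of the norm of K, that is, in K^o.  The
constructor keeps the neighbourhood filters folded when the lemmas below are
applied to a concrete field. *)
Variant tendsto u a : Prop :=
  Tendsto of (u n : K^o) @[n --> \oo] --> (a : K^o).

Lemma tendstoP u a : tendsto u a <-> (u n : K^o) @[n --> \oo] --> (a : K^o).
Proof. by split=> [[]|]. Qed.

Lemma eq_tendsto u v a : tendsto u a -> (forall n, u n = v n) -> tendsto v a.
Proof. by move=> ua /funext <-. Qed.

Lemma tendstoM u v a b :
  tendsto u a -> tendsto v b -> tendsto (fun n => u n * v n) (a * b).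
Proof. by move=> [ua] [vb]; split; exact: (cvgM ua vb). Qed.

Lemma tendstoD u v a b :
  tendsto u a -> tendsto v b -> tendsto (fun n => u n + v n) (a + b).
Proof. by move=> [ua] [vb]; split; exact: (cvgD ua vb). Qed.

Lemma tendstoV u a :
  a != 0 -> tendsto u a -> tendsto (fun n => (u n)^-1) a^-1.
Proof. by move=> a0 [ua]; split; exact: (cvgV a0 ua). Qed.

Lemma tendsto_cst a : tendsto (fun=> a) a.
Proof. by split; exact: cvg_cst. Qed.

Lemma tendsto_uniq u a b : tendsto u a -> tendsto u b -> a = b.
Proof. by move=> [ua] [ub]; exact: (cvg_unique (@norm_hausdorff _ K^o) ua ub). Qed.

Lemma tendsto_limn u a : tendsto u a -> limn (u : nat -> K^o) = a.
Proof. by move=> [ua]; exact: (cvg_lim (@norm_hausdorff _ K^o) ua). Qed.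

Lemma tendsto_comp u (f : nat -> nat) c a :
  (forall n, (n <= f n + c)%N) -> tendsto u a -> tendsto (fun n => u (f n)) a.
Proof.
move=> nf [ua]; split; apply: cvg_comp ua => A [N _ NA]; exists (N + c)%N => // n /= Nn.
by apply: NA => /=; rewrite -(leq_add2r c); exact: leq_trans (nf n).
Qed.

End Tendsto.

Section ComplexLimits.
Variable R : realType.
Implicit Types (u : nat -> R[i]) (l : R[i]).

Lemma tendsto_normc u l :
  tendsto u l <-> (normc (u n - l) : R) @[n --> \oo] --> (0 : R).
Proof.
rewrite tendstoP; split=> [h|/cvgr0Pnorm_lt h].
- apply/cvgr0Pnorm_lt => e e0; move/cvgrPdist_lt: h => /(_ e%:C%C).
  rewrite ltcR => /(_ e0); apply: filterS => n.
  by rewrite distrC ltcR ger0_norm ?normc_ge0.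
- apply/cvgrPdist_lt => e e0; have h0 := gtr0_real e0.
  move: e0; rewrite -(RRe_real h0) ltcR => /h; apply: filterS => n.
  by rewrite distrC ger0_norm ?normc_ge0 // => hh; rewrite /Num.Def.normr /= ltcR.
Qed.

Lemma tendsto_eps u l :
  tendsto u l <-> forall e : R, 0 < e ->
    exists N, forall n, (N <= n)%N -> normc (u n - l) < e.
Proof.
rewrite tendsto_normc; split=> [/cvgr0Pnorm_lt h e e0|h].
- have [N _ NP] := h e e0; exists N => n Nn.
  by have := NP n Nn; rewrite ger0_norm ?normc_ge0.
- apply/cvgr0Pnorm_lt => e e0; have [N NP] := h e e0; exists N => // n /= Nn.
  by rewrite ger0_norm ?normc_ge0 ?NP.
Qed.

End ComplexLimits.

(** * Geometrically bounded series and dominated convergence *)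

Section Geometric.
Variable R : realType.
Implicit Types (u : nat -> R[i]) (l : R[i]) (C r : R).

Lemma real_geometric_cvg (v : nat -> R) C r : 0 <= r < 1 ->
  (forall n, `|v n.+1 - v n| <= C * r ^+ n) -> cvgn v.
Proof.
move=> /andP[r0 r1] hv.
have C0 : 0 <= C by have := hv 0%N; rewrite expr0 mulr1; apply: le_trans.
have -> : v = (fun n => v 0%N + series (telescope v) n).
  by apply/funext => n; rewrite seriesEnat /= telescope_sumr// addrC subrK.
apply: is_cvgD; first exact: is_cvg_cst.
apply: normed_cvg; apply: (@series_le_cvg _ _ (geometric C r)); last first.
- by apply: is_cvg_geometric_series; rewrite ger0_norm.
- exact: hv.
- by move=> n; apply: mulr_ge0 => //; exact: exprn_ge0.
- by move=> n; exact: normr_ge0.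
Qed.

(** Completeness of the complex numbers, inherited from the real and
imaginary parts. *)
Lemma geometric_tendsto u C r : 0 <= r < 1 ->
  (forall n, normc (u n.+1 - u n) <= C * r ^+ n) -> exists l, tendsto u l.
Proof.
move=> hr hu.
have /cvg_ex[a ha] : cvgn (fun n => complex.Re (u n)).
  apply: real_geometric_cvg hr _ => n; apply: le_trans (hu n).
  by apply: le_trans (Re_le_normc _); case: (u n.+1) (u n) => [? ?] [? ?].
have /cvg_ex[b hb] : cvgn (fun n => complex.Im (u n)).
  apply: real_geometric_cvg hr _ => n; apply: le_trans (hu n).
  by apply: le_trans (Im_le_normc _); case: (u n.+1) (u n) => [? ?] [? ?].
exists (a +i* b)%C; apply/tendsto_normc/cvgr0Pnorm_lt => e e0.
have e2 : 0 < e / 2 by lra.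
move/cvgrPdist_lt: ha => /(_ _ e2); move/cvgrPdist_lt: hb => /(_ _ e2).
apply: filterS2 => n ha hb; rewrite ger0_norm ?normc_ge0//.
apply: le_lt_trans (normc_le_ReIm _) _.
by move: ha hb; case: (u n) => [x y] /=; rewrite ![ `|_ - x|]distrC ![ `|_ - y|]distrC; lra.
Qed.

Lemma sum_geometric_lt C r m n : 0 <= C -> 0 <= r < 1 ->
  \sum_(m <= j < n) C * r ^+ j <= C * r ^+ m / (1 - r).
Proof.
move=> C0 /andP[r0 r1]; case: (leqP m n) => [mn|nm]; last first.
  by rewrite big_geq ?(ltnW nm)// divr_ge0 ?mulr_ge0 ?exprn_ge0//; lra.
rewrite ler_pdivlMr; last lra.
suff -> : (\sum_(m <= j < n) C * r ^+ j) * (1 - r) = C * r ^+ m - C * r ^+ n.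
  by rewrite gerBl mulr_ge0 ?exprn_ge0.
elim: n mn => [|n IHn]; first by rewrite leqn0 => /eqP->; rewrite big_geq// mul0r subrr.
rewrite leq_eqVlt => /predU1P[->|]; first by rewrite big_geq// mul0r subrr.
by rewrite ltnS => mn; rewrite big_nat_recr//= mulrDl IHn// exprS; ring.
Qed.

Lemma sum_geometric_ord C r n : 0 <= C -> 0 <= r < 1 ->
  \sum_(j < n) C * r ^+ j <= C / (1 - r).
Proof.
move=> C0 hr; rewrite -(big_mkord xpredT (fun j => C * r ^+ j)).
by apply: le_trans (sum_geometric_lt _ _ C0 hr) _; rewrite expr0 mulr1.
Qed.

Lemma series_geometric_tendsto (A : nat -> R[i]) C r : 0 <= r < 1 ->
  (forall n, normc (A n) <= C * r ^+ n) ->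
  exists l, tendsto (fun n => \sum_(j < n) A j) l.
Proof.
move=> hr hA; apply: (geometric_tendsto hr) => n.
by rewrite big_ord_recr /= addrAC subrr add0r.
Qed.

Lemma tendsto_sum_null n (F : nat -> nat -> R[i]) :
  (forall j, tendsto (F^~ j) 0) -> tendsto (fun L => \sum_(j < n) F L j) 0.
Proof.
move=> hF; elim: n => [|n IHn].
  by apply: (eq_tendsto (tendsto_cst (0 : R[i]))) => L; rewrite big_ord0.
have := tendstoD IHn (hF n); rewrite addr0 => /eq_tendsto; apply => L.
by rewrite big_ord_recr.
Qed.

Lemma expr_small r e : 0 <= r < 1 -> 0 < e -> exists N, r ^+ N < e.
Proof.
move=> /andP[r0 r1] e0.
have /cvg_expr : `|r| < 1 by rewrite ger0_norm.
move/cvgr0Pnorm_lt => /(_ _ e0)[N _ /(_ N (leqnn N))] /=.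
by rewrite ger0_norm ?exprn_ge0// => h; exists N.
Qed.

(** Dominated convergence (Tannery's theorem) for a geometric majorant.  All the
columns of b have the same limit beta, because b will always be a product of
reciprocals of shifted factorials whose indices tend to infinity with L. *)
Lemma tannery (A : nat -> R[i]) (b : nat -> nat -> R[i]) beta s C B r :
  0 <= r < 1 -> (forall n, normc (A n) <= C * r ^+ n) ->
  (forall L n, normc (b L n) <= B) -> (forall n, tendsto (b^~ n) beta) ->
  tendsto (fun n => \sum_(j < n) A j) s ->
  tendsto (fun L => \sum_(j < L) A j * b L j) (s * beta).
Proof.
move=> hr hA hb hbeta hs; have /andP[r0 r1] := hr.
have C0 : 0 <= C.
  by have := hA 0%N; rewrite expr0 mulr1; apply: le_trans; exact: normc_ge0.
have B0 : 0 <= B by apply: le_trans (hb 0%N 0%N); exact: normc_ge0.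
rewrite [s * beta](_ : _ = 0 + s * beta); last by rewrite add0r.
suff h0 : tendsto (fun L => \sum_(j < L) A j * (b L j - beta)) 0.
  have := tendstoD h0 (tendstoM hs (tendsto_cst beta)); move/eq_tendsto; apply=> L.
  rewrite mulr_suml -big_split /=.
  by apply: eq_bigr => j _; rewrite mulrBr subrK.
apply/tendsto_eps => e e0; set B' := B + normc beta.
have B'0 : 0 <= B' by rewrite addr_ge0 ?normc_ge0.
pose D := C * B' / (1 - r).
have D0 : 0 <= D by rewrite divr_ge0 ?mulr_ge0//; lra.
have [M hM] : exists M, r ^+ M < e / 2 / (D + 1).
  by apply: expr_small hr _; rewrite divr_gt0//; lra.
have tailM : D * r ^+ M < e / 2.
  have := exprn_ge0 M r0; move: hM; rewrite ltr_pdivlMr; last lra.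
  by rewrite mulrDr mulr1 [D * _]mulrC; lra.
have /tendsto_eps/(_ (e / 2))[|N hN] :
    tendsto (fun L => \sum_(j < M) A j * (b L j - beta)) 0.
- apply: (@tendsto_sum_null M (fun L j => A j * (b L j - beta))) => j.
  rewrite -[0](mulr0 (A j)); apply: tendstoM; first exact: tendsto_cst.
  by rewrite -(subrr beta); apply: tendstoD => //; exact: tendsto_cst.
- lra.
exists (maxn N M) => L; rewrite geq_max => /andP[NL ML]; rewrite subr0.
rewrite -(big_mkord xpredT (fun j => A j * (b L j - beta))).
rewrite (big_cat_nat (n := M))//= big_mkord.
apply: le_lt_trans (le_normcD _ _) _.
have := hN L NL; rewrite subr0 => h1.
suff h2 : normc (\sum_(M <= j < L) A j * (b L j - beta)) <= D * r ^+ M by lra.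
apply: le_trans (normc_sum _ _ _) _.
have -> : D * r ^+ M = (C * B') * r ^+ M / (1 - r) by rewrite /D; ring.
apply: le_trans (sum_geometric_lt M L (mulr_ge0 C0 B'0) hr).
apply: ler_sum => j _; rewrite normcM mulrAC.
apply: ler_pM; rewrite ?normc_ge0//.
by apply: le_trans (le_normcD _ _) _; rewrite normcN lerD.
Qed.

End Geometric.

(** * Infinite q-shifted factorials *)

Section InfiniteProduct.
Variable R : realType.
Implicit Types (u : nat -> R[i]) (a q : R[i]) (C r : R).

Lemma prod_geometric_bounded u C r n : 0 <= r < 1 ->
  (forall m, normc (u m) <= C * r ^+ m) ->
  normc (\prod_(m < n) (1 + u m)) <= expR (C / (1 - r)).
Proof.
move=> hr hu.
have C0 : 0 <= C.
  by have := hu 0%N; rewrite expr0 mulr1; apply: le_trans; exact: normc_ge0.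
rewrite normc_prod; apply: (@le_trans _ _ (\prod_(m < n) expR (C * r ^+ m))).
  apply: ler_prod => m _; rewrite normc_ge0 /=.
  apply: le_trans (le_normcD _ _) _; rewrite normc1.
  by apply: le_trans (expR_ge1Dx _); rewrite lerD2l hu.
by rewrite -expR_sum ler_expR sum_geometric_ord.
Qed.

Lemma prod_geometric_tendsto u C r : 0 <= r < 1 ->
  (forall m, normc (u m) <= C * r ^+ m) ->
  exists l, tendsto (fun n => \prod_(m < n) (1 + u m)) l.
Proof.
move=> hr hu; apply: (@geometric_tendsto _ _ (expR (C / (1 - r)) * C) r) => // n.
rewrite big_ord_recr /= mulrDr mulr1 addrAC subrr add0r normcM -mulrA.
by rewrite ler_pM ?normc_ge0 ?hu// prod_geometric_bounded.
Qed.

Lemma one_sub_neq0 a : normc a < 1 -> 1 - a != 0.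
Proof.
by move=> ha; apply/eqP => h; have := normc_sub_ge 1 a; rewrite h normc1 normc0; lra.
Qed.

Lemma normc_mul_exp_lt1 a q m : normc a < 1 -> normc q < 1 -> normc (a * q ^+ m) < 1.
Proof.
move=> ha hq; rewrite normcM normc_exp; apply: le_lt_trans ha.
by rewrite ler_piMr ?normc_ge0// exprn_ile1 ?normc_ge0// ltW.
Qed.

Lemma one_sub_exp_neq0 q n : normc q < 1 -> 1 - q ^+ n.+1 != 0.
Proof. by move=> q1; rewrite exprS one_sub_neq0// normc_mul_exp_lt1. Qed.

(** The reciprocals 1/(a; q)_n are themselves the partial products of
1 + a q^m / (1 - a q^m), so they converge; as the product of the limits of
(a; q)_n and of its reciprocal is 1, neither limit vanishes. *)
Lemma qpoch_inv_spec a q : normc a < 1 -> normc q < 1 ->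
  (exists2 B, 0 <= B & forall n, normc (qpoch a q n)^-1 <= B)
  /\ exists2 l, tendsto (fun n => (qpoch a q n)^-1) l & tendsto (qpoch a q) l^-1 /\ l != 0.
Proof.
move=> ha hq.
have hr : 0 <= normc q < 1 by rewrite normc_ge0.
have a0 := normc_ge0 a.
have nz m : 1 - a * q ^+ m != 0 by apply/one_sub_neq0/normc_mul_exp_lt1.
pose u m := a * q ^+ m / (1 - a * q ^+ m).
have invE n : (qpoch a q n)^-1 = \prod_(m < n) (1 + u m).
  rewrite /qpoch -prodfV; apply: eq_bigr => m _; rewrite /u; move: (nz m).
  by move: (a * _) => z hz; field.
have hu m : normc (u m) <= normc a / (1 - normc a) * normc q ^+ m.
  rewrite /u normcM normcV mulrAC -normc_exp -normcM.
  have h := normc_mul_exp_lt1 m ha hq.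
  rewrite ler_pM ?normc_ge0 ?invr_ge0 ?normc_ge0// lef_pV2 ?posrE; last 2 first.
  - by apply: lt_le_trans (normc_sub_ge _ _); rewrite normc1; lra.
  - by lra.
  apply: le_trans (normc_sub_ge _ _); rewrite normc1 lerD2l lerN2.
  rewrite normcM normc_exp.
  by rewrite ler_piMr ?normc_ge0// exprn_ile1 ?normc_ge0// ltW.
split.
  exists (expR (normc a / (1 - normc a) / (1 - normc q))); first exact: expR_ge0.
  by move=> n; rewrite invE prod_geometric_bounded.
have [l hl] := prod_geometric_tendsto hr hu.
have hl' : tendsto (fun n => (qpoch a q n)^-1) l.
  by move/eq_tendsto: hl; apply => n; rewrite invE.
have [k hk] : exists k, tendsto (qpoch a q) k.
  have [k hk] := @prod_geometric_tendsto (fun m => - (a * q ^+ m)) (normc a) _ hr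
    (fun m => ltac:(by rewrite normcN normcM normc_exp)).
  by exists k; move/eq_tendsto: hk; apply.
have kl : k * l = 1.
  apply: (@tendsto_uniq _ (fun=> 1)); last exact: tendsto_cst.
  move/eq_tendsto: (tendstoM hk hl'); apply => n.
  by rewrite divff// /qpoch; apply/prodf_neq0 => m _.
have l0 : l != 0 by apply: contra_eq_neq kl => ->; rewrite mulr0 eq_sym oner_eq0.
by exists l => //; split=> //; rewrite -[l^-1]mul1r -kl mulfK.
Qed.

Lemma qpoch_inf_tendsto a q : normc a < 1 -> normc q < 1 ->
  tendsto (qpoch a q) (qpoch_inf a q).
Proof.
move=> ha hq; have [_ [l _ [hl _]]] := qpoch_inv_spec ha hq.
by rewrite /qpoch_inf (tendsto_limn hl).
Qed.

Lemma qpoch_inf_neq0 a q : normc a < 1 -> normc q < 1 -> qpoch_inf a q != 0.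
Proof.
move=> ha hq; have [_ [l _ [hl l0]]] := qpoch_inv_spec ha hq.
by rewrite /qpoch_inf (tendsto_limn hl) invr_eq0.
Qed.

Lemma qpoch_inv_tendsto a q : normc a < 1 -> normc q < 1 ->
  tendsto (fun n => (qpoch a q n)^-1) (qpoch_inf a q)^-1.
Proof.
by move=> ha hq; apply: tendstoV; [exact: qpoch_inf_neq0|exact: qpoch_inf_tendsto].
Qed.

Lemma qpoch_inv_bounded a q : normc a < 1 -> normc q < 1 ->
  exists2 B, 0 <= B & forall n, normc (qpoch a q n)^-1 <= B.
Proof. by move=> ha hq; have [] := qpoch_inv_spec ha hq. Qed.

End InfiniteProduct.

(** * The q-Vandermonde sum and the Bailey chain *)

Lemma triangle_sum (V : nmodType) (f : nat -> nat -> V) L :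
  \sum_(N < L.+1) \sum_(r < N.+1) f N r =
  \sum_(r < L.+1) \sum_(t < (L - r).+1) f (r + t)%N r.
Proof.
elim: L => [|L IHL]; first by rewrite !big_ord_recl !big_ord0.
rewrite big_ord_recr /= {}IHL [RHS]big_ord_recr /= subnn.
rewrite [\sum_(t < 1) _]big_ord_recr big_ord0 /= add0r addn0.
rewrite [in LHS](big_ord_recr L.+1) /= addrA; congr (_ + _).
rewrite -big_split; apply: eq_bigr => r _ /=.
have rL : (r <= L)%N by rewrite -ltnS.
by rewrite subSn// [RHS]big_ord_recr /= addnS subnKC.
Qed.

Lemma qpochS (A : comPzRingType) (a q : A) n :
  qpoch a q n.+1 = qpoch a q n * (1 - a * q ^+ n).
Proof. by rewrite /qpoch big_ord_recr. Qed.

Section Bailey.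
Variables (F : fieldType) (q : F).
Hypothesis q_neq : forall n, 1 - q ^+ n.+1 != 0.
Local Notation iq n := (qpoch q q n)^-1.

Lemma qpoch_inv_recr n : iq n = (1 - q ^+ n.+1) * iq n.+1.
Proof.
by rewrite qpochS -exprS invfM mulrC -mulrA mulVf ?mulr1.
Qed.

Lemma qpoch_inv0 : iq 0 = 1. Proof. by rewrite /qpoch big_ord0 invr1. Qed.

(** Induction on M: multiply by 1 - q^M = (1 - q^(M-t)) + q^(M-t) (1 - q^t).
The first part gives the sum for (M-1, m), the second q^(M+m) times the sum for
(M-1, m+1). *)
Lemma q_vandermonde M m :
  \sum_(t < M.+1) q ^+ (t * (t + m)) * (iq (M - t) * (iq t * iq (t + m)))
  = iq M * iq (M + m).
Proof.
elim: M m => [|M IHM] m; first by rewrite big_ord1 mul0n expr0 mul1r qpoch_inv0 mul1r.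
apply: (mulfI (q_neq M)).
rewrite mulrA -qpoch_inv_recr mulr_sumr.
pose f n t := q ^+ (t * (t + n)) * (iq (M - t) * (iq t * iq (t + n))).
transitivity (\sum_(t < M.+1) f m t + q ^+ (M.+1 + m) * \sum_(t < M.+1) f m.+1 t).
  transitivity (\sum_(t < M.+2)
     ((1 - q ^+ (M.+1 - t)) * (q ^+ (t * (t + m)) * (iq (M.+1 - t) * (iq t * iq (t + m))))
     + q ^+ (M.+1 - t) * (1 - q ^+ t)
       * (q ^+ (t * (t + m)) * (iq (M.+1 - t) * (iq t * iq (t + m)))))).
    apply: eq_bigr => t _; rewrite -mulrDl; congr (_ * _).
    rewrite -{1}(@subnK t M.+1) ?exprD; last by rewrite -ltnS.
    by ring.
  rewrite big_split /=; congr (_ + _).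
    rewrite big_ord_recr /= subnn expr0 subrr mul0r addr0.
    apply: eq_bigr => t _; rewrite /f subSn; last by rewrite -ltnS.
    by rewrite [iq (M - t)]qpoch_inv_recr; ring.
  rewrite big_ord_recl /= expr0 subrr mulr0 mul0r add0r mulr_sumr.
  apply: eq_bigr => t _; rewrite /f /bump /= add1n subSS [iq t]qpoch_inv_recr addnS.
  have tM : (t <= M)%N by rewrite -ltnS.
  rewrite [RHS]mulrA -exprD.
  have -> : (M.+1 + m + t * (t + m).+1 = M - t + t.+1 * (t.+1 + m))%N by nia.
  by rewrite exprD addSn; ring.
rewrite /f !IHM addnS [iq (M + m)]qpoch_inv_recr addSn; ring.
Qed.

(** Bailey's lemma: exchange the two sums and put N = r + t; the inner sum over
t is a q-Vandermonde sum. *)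
Lemma bailey_chain (G alpha : nat -> F) e :
  (forall N, G N = \sum_(r < N.+1) alpha r * (iq (N - r) * iq (N + r + e))) ->
  forall L, \sum_(N < L.+1) q ^+ (N * (N + e)) * iq (L - N) * G N =
    \sum_(r < L.+1) alpha r * q ^+ (r * (r + e)) * (iq (L - r) * iq (L + r + e)).
Proof.
move=> hG L; under eq_bigr do rewrite hG mulr_sumr.
rewrite (triangle_sum (fun N r => q ^+ (N * (N + e)) * iq (L - N) *
   (alpha r * (iq (N - r) * iq (N + r + e))))).
apply: eq_bigr => r _; have rL : (r <= L)%N by rewrite -ltnS.
have -> : (L + r + e = L - r + (r.*2 + e))%N by lia.
rewrite -q_vandermonde mulr_sumr; apply: eq_bigr => t _.
have tL : (t <= L - r)%N by rewrite -ltnS.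
rewrite addKn subnDA.
have -> : (r + t + r + e = t + (r.*2 + e))%N by lia.
have -> : ((r + t) * (r + t + e) = r * (r + e) + t * (t + (r.*2 + e)))%N by nia.
by rewrite exprD; ring.
Qed.

End Bailey.

(** * The initial Bailey pair and the Bailey lattice *)

Lemma bin2D m n : 'C(m + n, 2) = ('C(m, 2) + 'C(n, 2) + m * n)%N.
Proof.
elim: m => [|m IHm]; first by rewrite add0n mul0n addn0.
by rewrite addSn !binS !bin1 IHm mulSn; lia.
Qed.

Section BaileyPair.
Variables (F : fieldType) (q : F).
Hypothesis q_neq : forall n, 1 - q ^+ n.+1 != 0.
Local Notation iq n := (qpoch q q n)^-1.

(** The factors of the summand that depend on the innermost index only. *)
Definition seed l n := iq n * iq (n + 2 * l) * Defs.ratio q l n.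

Definition seed_alpha l r := (-1) ^+ r * q ^+ ('C(r, 2) + l * r).

(** The sum telescopes: with x = q^(l+r) and y = q^(l+n), consecutive terms are
matched by (1 - x) (1 - q x y) + (1 - q x) (x - y) = (1 - y) (1 - q x^2). *)
Lemma seed_pair l n : seed l n =
  \sum_(r < n.+1) seed_alpha l r * (1 - q ^+ (2 * r + 2 * l + 1))
                  * (iq (n - r) * iq (n + r + (2 * l + 1))).
Proof.
have [nl0|nl0] := eqVneq (l + n)%N 0%N.
  have [-> ->] : l = 0%N /\ n = 0%N by lia.
  rewrite big_ord1 /seed /Defs.ratio /seed_alpha /= !muln0 !expr0 !mulr1 mul1r.
  by rewrite !add0n [in RHS]mulrCA -qpoch_inv_recr.
have yN : 1 - q ^+ (l + n) != 0 by case: (l + n)%N nl0 => // m _; exact: q_neq.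
(* The partial sum up to r is U 0 - U r. *)
pose U r := seed_alpha l r * (1 - q ^+ (l + r)) * (iq (n - r) * iq (n + r + 2 * l))
            / (1 - q ^+ (l + n)).
have lastU : U n = seed_alpha l n * (1 - q ^+ (2 * n + 2 * l + 1))
                  * (iq (n - n) * iq (n + n + (2 * l + 1))).
  rewrite /U mulrAC mulfK// addnA addn1 addn1 (_ : n + n + 2 * l = 2 * n + 2 * l)%N; last lia.
  by rewrite [iq (2 * n + 2 * l)](qpoch_inv_recr q_neq); ring.
have partU j : (j <= n)%N -> \sum_(r < j) seed_alpha l r * (1 - q ^+ (2 * r + 2 * l + 1))
                  * (iq (n - r) * iq (n + r + (2 * l + 1))) = U 0%N - U j.
  elim: j => [|j IHj] jn; first by rewrite big_ord0 subrr.
  rewrite big_ord_recr /= {}IHj ?(ltnW jn)// -addrA; congr (_ + _).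
  rewrite /U addn1.
  have -> : (n + j.+1 + 2 * l = (n + j + 2 * l).+1)%N by lia.
  have -> : (n + j + (2 * l + 1) = (n + j + 2 * l).+1)%N by lia.
  have -> : (n - j = (n - j.+1).+1)%N by lia.
  rewrite [iq (n - j.+1)](qpoch_inv_recr q_neq) [iq (n + j + 2 * l)](qpoch_inv_recr q_neq).
  have -> : seed_alpha l j.+1 = - q ^+ (l + j) * seed_alpha l j.
    rewrite /seed_alpha binS bin1 (_ : _ + _ + _ = (l + j) + ('C(j, 2) + l * j))%N; last lia.
    by rewrite exprD exprS; ring.
  apply: (mulIf yN); rewrite mulrDl -mulNr !mulfVK// mulNr mulfVK//.
  rewrite -subSn// subSS.
  have <- : q ^+ (n - j) * q ^+ (l + j) = q ^+ (l + n).
    by rewrite -exprD; congr (_ ^+ _); lia.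
  have -> : q ^+ (n + j + 2 * l).+1 = q * q ^+ (n - j) * q ^+ (l + j) * q ^+ (l + j).
    by rewrite -exprS -!exprD; congr (_ ^+ _); lia.
  have -> : q ^+ (2 * j + 2 * l).+1 = q * q ^+ (l + j) * q ^+ (l + j).
    by rewrite -exprS -!exprD; congr (_ ^+ _); lia.
  have -> : q ^+ (l + j.+1) = q * q ^+ (l + j) by rewrite addnS exprS.
  ring.
rewrite big_ord_recr /= partU// lastU subrK /U /seed_alpha bin0n muln0 !expr0 subn0 !addn0.
rewrite !mul1r /seed /Defs.ratio; case: eqP => [l0|_]; last by ring.
rewrite l0 expr0 subrr !mul0r.
by case: n {U lastU partU yN} nl0 => [|n] //; [rewrite l0|rewrite mulr0].
Qed.

(** The list holds the linear coefficients e of the weights q^(M^2 + e M),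
outermost sum first. *)
Fixpoint nest (f : nat -> F) (es : seq nat) : nat -> F :=
  if es is e :: es' then fun N =>
    \sum_(M < N.+1) q ^+ (M * (M + e)) * iq (N - M) * nest f es' M
  else f.

Lemma nest_cat f es es' : nest f (es ++ es') = nest (nest f es') es.
Proof. by elim: es => //= e es ->. Qed.

Lemma nest_nseq (f alpha : nat -> F) e m :
  (forall N, f N = \sum_(r < N.+1) alpha r * (iq (N - r) * iq (N + r + e))) ->
  forall N, nest f (nseq m e) N =
    \sum_(r < N.+1) alpha r * q ^+ (m * (r * (r + e))) * (iq (N - r) * iq (N + r + e)).
Proof.
move=> hf; elim: m => [|m IHm] N; first by under eq_bigr do rewrite mul0n expr0 mulr1.
rewrite /= (bailey_chain q_neq
  (alpha := fun r => alpha r * q ^+ (m * (r * (r + e)))) IHm).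
apply: eq_bigr => r _.
by rewrite mulSn exprD; ring.
Qed.

Lemma sum_shift_sub (a c X : nat -> F) L :
  \sum_(r < L.+1) (a r - (if (r : nat) is r'.+1 then c r' else 0)) * X r =
  \sum_(r < L.+1) a r * X r - \sum_(r < L) c r * X r.+1.
Proof.
under eq_bigr do rewrite mulrBl; rewrite sumrB; congr (_ - _).
by rewrite big_ord_recl /= mul0r add0r.
Qed.

(** Passage from the parameter e + 1 to e: both neighbouring kernels are multiples
of the kernel for e + 1, and
(1 - q^(N+r+e+1)) - q^(2r+e+1) (1 - q^(N-r)) = 1 - q^(2r+e+1). *)
Lemma bailey_lower (a : nat -> F) e N :
  \sum_(r < N.+1) a r * (1 - q ^+ (2 * r + e + 1)) * (iq (N - r) * iq (N + r + (e + 1)))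
  = \sum_(r < N.+1) (a r - (if (r : nat) is r'.+1 then a r' * q ^+ (2 * r' + e + 1) else 0))
      * (iq (N - r) * iq (N + r + e)).
Proof.
rewrite (sum_shift_sub a (fun r => a r * q ^+ (2 * r + e + 1))
  (fun r => iq (N - r) * iq (N + r + e))).
rewrite 2!(big_ord_recr N) /= addrAC -sumrB; congr (_ + _).
  apply: eq_bigr => r _; have rN := ltn_ord r.
  have -> : (N + r.+1 + e = (N + r + e).+1)%N by lia.
  have -> : (N + r + (e + 1) = (N + r + e).+1)%N by lia.
  rewrite addn1.
  have -> : (N - r = (N - r.+1).+1)%N by lia.
  rewrite [iq (N - r.+1)](qpoch_inv_recr q_neq) [iq (N + r + e)](qpoch_inv_recr q_neq).
  have -> : q ^+ (N + r + e).+1 = q ^+ (N - r.+1).+1 * q ^+ (2 * r + e).+1.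
    by rewrite -exprD; congr (_ ^+ _); lia.
  ring.
rewrite subnn addnA !addn1 [iq (N + N + e)](qpoch_inv_recr q_neq) (_ : 2 * N = N + N)%N; last lia.
by ring.
Qed.

(** The k-i inner steps act on the kernels for 2l+1, the i outer ones on those
for 2l; the coefficient of each kernel is finally split back into the two
contributions created by bailey_lower. *)
Lemma nest_bailey l i m L :
  nest (seed l) (nseq i (2 * l) ++ nseq m (2 * l + 1)) L =
  \sum_(r < L.+1) (seed_alpha l r * q ^+ (m * (r * (r + (2 * l + 1))))
     * q ^+ (i * (r * (r + 2 * l))))
     * (iq (L - r) * iq (L + r + 2 * l))
  - \sum_(r < L) (seed_alpha l r * q ^+ (m * (r * (r + (2 * l + 1)))) * q ^+ (2 * r + 2 * l + 1)
     * q ^+ (i * (r.+1 * (r.+1 + 2 * l))))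
     * (iq (L - r.+1) * iq (L + r.+1 + 2 * l)).
Proof.
pose a r := seed_alpha l r * q ^+ (m * (r * (r + (2 * l + 1)))).
rewrite nest_cat.
have h N : nest (seed l) (nseq m (2 * l + 1)) N =
    \sum_(r < N.+1) (a r - (if (r : nat) is r'.+1 then a r' * q ^+ (2 * r' + 2 * l + 1) else 0))
      * (iq (N - r) * iq (N + r + 2 * l)).
  rewrite (nest_nseq
    (alpha := fun r => seed_alpha l r * (1 - q ^+ (2 * r + 2 * l + 1))) m (seed_pair l)).
  rewrite -bailey_lower; apply: eq_bigr => r _.
  by rewrite /a; ring.
rewrite (nest_nseq (alpha :=
  fun r => a r - (if r is r'.+1 then a r' * q ^+ (2 * r' + 2 * l + 1) else 0)) i h).
rewrite -(sum_shift_sub (fun r => a r * q ^+ (i * (r * (r + 2 * l))))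
  (fun r => a r * q ^+ (2 * r + 2 * l + 1) * q ^+ (i * (r.+1 * (r.+1 + 2 * l))))
  (fun r => iq (L - r) * iq (L + r + 2 * l))).
apply: eq_bigr => -[r /= _] _; rewrite mulrBl mulrBl mulrBl; congr (_ - _).
by case: r => [|r]; rewrite ?mul0r.
Qed.

End BaileyPair.

(** * Jacobi's triple product *)

Section FiniteTripleProduct.
Variables (F : fieldType) (p : F).
Hypothesis p_neq : forall n, 1 - p ^+ n.+1 != 0.
Local Notation ip n := (qpoch p p n)^-1.

(** The terms of the theta series of x in base p with nonnegative index; those of
negative index -j are the terms of index j for y, where x y = p. *)
Definition theta_term (x : F) j := (-1) ^+ j * p ^+ 'C(j, 2) * x ^+ j.

Lemma theta_term_recr x j : theta_term x j.+1 = - (x * p ^+ j) * theta_term x j.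
Proof. by rewrite /theta_term binS bin1 exprD !exprS; ring. Qed.

(** The bilateral theta series listed from its term of index -b on. *)
Definition bilateral_term x y b m :=
  if (m < b)%N then theta_term y (b - m) else theta_term x (m - b).

Definition bilateral_sum x y a b :=
  \sum_(m < (a + b).+1) bilateral_term x y b m * (ip (a + b - m) * ip m).

Lemma bilateral_term_recr x y a b m : x * y = p -> (m <= a + b)%N ->
  bilateral_term x y b m.+1 * p ^+ (a + b - m) = - (x * p ^+ a) * bilateral_term x y b m.
Proof.
move=> xy mab; rewrite /bilateral_term; case: ltnP => mb.
  rewrite ltnW// (_ : b - m = (b - m.+1).+1)%N; last lia.
  rewrite theta_term_recr (_ : a + b - m = (a + (b - m.+1)).+1)%N; last lia.
  by rewrite exprS exprD -{1}xy; ring.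
have [mb'|mb'] := ltnP m b.
  have -> : (m.+1 - b = 0)%N by lia.
  have -> : (b - m = 1)%N by lia.
  rewrite (_ : a + b - m = a.+1)%N; last lia.
  by rewrite theta_term_recr /theta_term /= !expr0 exprS -{1}xy; ring.
rewrite subSn// theta_term_recr -[in RHS](@subnK (m - b) a); last lia.
by rewrite (_ : a + b - m = a - (m - b))%N; [rewrite exprD; ring|lia].
Qed.

(** The q-Pascal rule
1 - p^(N+1) = (1 - p^(N+1-m)) + p^(N+1-m) (1 - p^m), where the second part
shifts the theta series by one place, at the price of a factor - x p^a. *)
Lemma bilateral_sum_recr x y a b : x * y = p ->
  (1 - p ^+ (a + b).+1) * bilateral_sum x y a.+1 b = (1 - x * p ^+ a) * bilateral_sum x y a b.
Proof.
move=> xy; rewrite /bilateral_sum addSn; set N := (a + b)%N.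
pose c := bilateral_term x y b.
transitivity (\sum_(m < N.+2) ((1 - p ^+ (N.+1 - m)) * (c m * (ip (N.+1 - m) * ip m))
   + p ^+ (N.+1 - m) * (1 - p ^+ m) * (c m * (ip (N.+1 - m) * ip m)))).
  rewrite mulr_sumr; apply: eq_bigr => m _; rewrite -mulrDl; congr (_ * _).
  rewrite -{1}(@subnK m N.+1) ?exprD; last by rewrite -ltnS.
  by ring.
rewrite big_split /= [X in X + _]big_ord_recr [X in _ + X]big_ord_recl /= subnn.
rewrite expr0 subrr mulr0 !mul0r addr0 add0r.
rewrite -big_split /= mulr_sumr; apply: eq_bigr => m _.
have mN : (m <= N)%N by rewrite -ltnS.
rewrite /bump /= add1n subSS subSn// [ip (N - m)](qpoch_inv_recr p_neq).
rewrite [ip m](qpoch_inv_recr p_neq).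
have step := bilateral_term_recr xy mN; rewrite -/(c m) -/(c m.+1) -/N in step.
have -> (K : F) : (1 - x * p ^+ a) * (c m * K) = c m * K + c m.+1 * p ^+ (N - m) * K.
  by rewrite step; ring.
ring.
Qed.

Lemma bilateral_sumC x y a b : bilateral_sum x y a b = bilateral_sum y x b a.
Proof.
rewrite /bilateral_sum (reindex_inj rev_ord_inj) addnC; apply: eq_bigr => m _ /=.
have mN : (m <= b + a)%N by rewrite -ltnS.
rewrite subSS subKn//; congr (_ * _); last by rewrite mulrC.
rewrite /bilateral_term; case: ltnP => h1; case: ltnP => h2.
- by lia.
- by congr theta_term; lia.
- by congr theta_term; lia.
- have -> : (b + a - m - b = 0)%N by lia.
  by have -> : (m - a = 0)%N by lia.
Qed.

(** Each order of truncation is raised by bilateral_sum_recr, the two orders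
being exchanged by the symmetry bilateral_sumC. *)
Lemma finite_triple_product x y a b : x * y = p ->
  bilateral_sum x y a b = qpoch x p a * qpoch y p b * ip (a + b).
Proof.
have step u v c d : u * v = p ->
    bilateral_sum u v c d = qpoch u p c * qpoch v p d * ip (c + d) ->
    bilateral_sum u v c.+1 d = qpoch u p c.+1 * qpoch v p d * ip (c.+1 + d).
  move=> uv IH; apply: (mulfI (p_neq (c + d))).
  rewrite bilateral_sum_recr// IH addSn [ip (c + d)](qpoch_inv_recr p_neq).
  by rewrite (qpochS u); ring.
move=> xy; have yx : y * x = p by rewrite mulrC.
elim: a => [|a IHa]; last exact: step.
elim: b => [|b IHb].
  rewrite /bilateral_sum big_ord1 /qpoch !big_ord0 /bilateral_term /=.
  by rewrite /theta_term !expr0 invr1; ring.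
rewrite bilateral_sumC addnC [qpoch x p 0 * _]mulrC; apply: step => //.
by rewrite bilateral_sumC addnC [qpoch y p b * _]mulrC.
Qed.

Lemma bilateral_sum_split x y n :
  bilateral_sum x y n n = \sum_(j < n.+1) theta_term x j * (ip (n - j) * ip (n + j))
  + \sum_(j < n) theta_term y j.+1 * (ip (n - j.+1) * ip (n + j.+1)).
Proof.
rewrite /bilateral_sum -addnS big_split_ord /= addrC; congr (_ + _).
  apply: eq_bigr => j _; rewrite /bilateral_term ltnNge leq_addr /= addKn.
  by congr (_ * (ip _ * _)); lia.
rewrite (reindex_inj rev_ord_inj); apply: eq_bigr => j _ /=.
have jn := ltn_ord j; rewrite /bilateral_term.
rewrite (_ : (n - j.+1 < n)%N = true); last lia.
rewrite (_ : n - (n - j.+1) = j.+1)%N; last lia.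
by rewrite mulrC [RHS]mulrC; congr (_ * _); rewrite mulrC; congr (_ * ip _); lia.
Qed.

End FiniteTripleProduct.

Section TripleProduct.
Variables (R : realType) (p x y : R[i]).
Hypotheses (xy : x * y = p) (x1 : normc x < 1) (y1 : normc y < 1).

Lemma theta_term_bound (z : R[i]) j : normc p <= 1 -> normc (theta_term p z j) <= normc z ^+ j.
Proof.
move=> p1; rewrite /theta_term !normcM normc_sign mul1r !normc_exp.
by rewrite ler_piMl ?exprn_ge0 ?normc_ge0// exprn_ile1// normc_ge0.
Qed.

Lemma base_lt1 : normc p < 1.
Proof. by rewrite -xy normcM mulr_ilt1 ?normc_ge0. Qed.

(** Every kernel 1/((q)_f (q)_g) whose indices grow at least like L - j tends to
1/(q)_oo^2; this passes to the limit both in the finite triple product and in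
the Bailey lattice. *)
Lemma kernel_tendsto (q : R[i]) (A : nat -> R[i]) (f g : nat -> nat -> nat) C r s :
  0 <= r < 1 -> normc q < 1 -> (forall n, normc (A n) <= C * r ^+ n) ->
  (forall L j, L <= f L j + j.+1)%N -> (forall L j, L <= g L j + j.+1)%N ->
  tendsto (fun n => \sum_(j < n) A j) s ->
  tendsto (fun L => \sum_(j < L) A j * ((qpoch q q (f L j))^-1 * (qpoch q q (g L j))^-1))
    (s * (qpoch_inf q q)^-1 ^+ 2).
Proof.
move=> hr q1 hA hf hg hs.
have [B B0 hB] := qpoch_inv_bounded q1 q1.
have lim := qpoch_inv_tendsto q1 q1.
apply: (tannery (b := fun L j => (qpoch q q (f L j))^-1 * (qpoch q q (g L j))^-1)
   (B := B * B) hr hA _ _ hs).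
  by move=> L n; rewrite normcM ler_pM ?normc_ge0.
move=> j; rewrite expr2; apply: tendstoM.
  exact: (tendsto_comp (f := fun L => f L j) (hf^~ j) lim).
exact: (tendsto_comp (f := fun L => g L j) (hg^~ j) lim).
Qed.

Lemma theta_sum_cvg (z : R[i]) d : normc z < 1 ->
  exists s, tendsto (fun n => \sum_(j < n) theta_term p z (j + d)) s.
Proof.
move=> z1; have hz : 0 <= normc z < 1 by rewrite normc_ge0.
apply: (series_geometric_tendsto (A := fun j => theta_term p z (j + d)) (C := 1) hz) => n.
apply: le_trans (theta_term_bound _ _ (ltW base_lt1)) _.
by rewrite mul1r ler_wiXn2l ?normc_ge0 ?leq_addr// ltW.
Qed.

(** In the finite form, the product side tends to (x)_oo (y)_oo / (p)_oo and the
sum side to (s + t) / (p)_oo^2. *)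
Lemma jacobi_triple_product s t :
  tendsto (fun n => \sum_(j < n) theta_term p x j) s ->
  tendsto (fun n => \sum_(j < n) theta_term p y j.+1) t ->
  s + t = qpoch_inf x p * qpoch_inf y p * qpoch_inf p p.
Proof.
move=> hs ht; have p1 := base_lt1.
have hp n := one_sub_exp_neq0 n p1.
set P := qpoch_inf p p; have P0 : P != 0 by exact: qpoch_inf_neq0.
have hx : 0 <= normc x < 1 by rewrite normc_ge0.
have hy : 0 <= normc y < 1 by rewrite normc_ge0.
have bx n : normc (theta_term p x n) <= 1 * normc x ^+ n.
  by rewrite mul1r theta_term_bound ?ltW.
have yb n : normc (theta_term p y n.+1) <= 1 * normc y ^+ n.
  rewrite mul1r; apply: le_trans (theta_term_bound _ _ (ltW p1)) _.
  by rewrite exprS ler_piMl ?exprn_ge0 ?normc_ge0 ?ltW.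
(* The half of the sum with nonnegative indices has n + 1 terms, hence L.-1. *)
have lx := @kernel_tendsto p _ (fun L j => (L - j.+1)%N) (fun L j => (L.-1 + j)%N) _ _ _
  hx p1 bx (fun L j => ltac:(lia)) (fun L j => ltac:(lia)) hs.
have ly := @kernel_tendsto p _ (fun L j => (L - j.+1)%N) (fun L j => (L + j.+1)%N) _ _ _
  hy p1 yb (fun L j => ltac:(lia)) (fun L j => ltac:(lia)) ht.
have lim1 : tendsto (fun n => bilateral_sum p x y n n) (s * P^-1 ^+ 2 + t * P^-1 ^+ 2).
  apply: eq_tendsto; last by move=> n; rewrite bilateral_sum_split.
  apply: tendstoD.
  - by apply: (tendsto_comp (f := succn) (c := 0) _ lx) => n; lia.
  - exact: ly.
have lim2 : tendsto (fun n => bilateral_sum p x y n n)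
   (qpoch_inf x p * qpoch_inf y p * P^-1).
  apply: eq_tendsto; last by move=> n; rewrite (finite_triple_product hp).
  apply: tendstoM.
    by apply: tendstoM; exact: qpoch_inf_tendsto.
  apply: (tendsto_comp (f := fun n => (n + n)%N) (c := 0) _ (qpoch_inv_tendsto p1 p1)).
  by move=> n; lia.
have := tendsto_uniq lim1 lim2; rewrite -mulrDl => h.
have -> : s + t = ((s + t) * P^-1 ^+ 2) * P ^+ 2 by field.
by rewrite h; field.
Qed.

End TripleProduct.

(** * Unordered sums arranged in finite layers *)

Lemma summability_sum_eq (K : numFieldType) (I : choiceType) (f : I -> K) (s : K) :
  (forall e : K, 0 < e -> exists A0 : {fset I}, forall J : {fset I},
     (A0 `<=` J)%fset -> `|s - partial_sum f J| < e) ->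
  summability.sum (f : I -> K^o) = s.
Proof.
move=> h; have FF := @totally_filter I; apply: (cvg_lim (@norm_hausdorff _ K^o)).
apply/cvgrPdist_lt => e e0; have [A0 hA0] := h e e0.
by exists A0 => // J; exact: hA0.
Qed.

Section LayeredSum.
Variables (R : realType) (I : choiceType).
Variables (f : I -> R[i]) (deg : I -> nat) (layer : nat -> seq I).
Hypothesis layer_uniq : forall N, uniq (layer N).
Hypothesis mem_layer : forall N j, (j \in layer N) = (deg j == N).

Lemma layered_partial_sum (J : {fset I}) L : (forall j, j \in J -> (deg j < L)%N) ->
  partial_sum f J = \sum_(N < L) \sum_(j <- layer N | j \in J) f j.
Proof.
move=> hL; rewrite /partial_sum -(big_seq_fsetE _ J xpredT) /=.
transitivity (\sum_(j <- J) \sum_(N < L | deg j == N) f j).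
  rewrite big_seq [RHS]big_seq; apply: eq_bigr => j jJ.
  by rewrite (big_pred1 (Ordinal (hL _ jJ))).
rewrite (exchange_big_dep xpredT)//=; apply: eq_bigr => N _.
rewrite -big_filter -[RHS]big_filter; apply/perm_big/uniq_perm.
- by rewrite filter_uniq.
- by rewrite filter_uniq.
- by move=> j; rewrite !mem_filter mem_layer andbC.
Qed.

(** A finite set that contains the first M layers differs from their union by
elements of later layers, whose contribution is a geometric tail. *)
Lemma layered_sum C r s : 0 <= r < 1 ->
  (forall N, \sum_(j <- layer N) normc (f j) <= C * r ^+ N) ->
  tendsto (fun L => \sum_(N < L) \sum_(j <- layer N) f j) s ->
  summability.sum (f : I -> R[i]^o) = s.
Proof.
move=> hr hC /tendsto_eps hs; have /andP[r0 r1] := hr.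
have C0 : 0 <= C.
  have := hC 0%N; rewrite expr0 mulr1; apply: le_trans.
  by apply: sumr_ge0 => j _; exact: normc_ge0.
apply: summability_sum_eq => e e0.
have h0 := gtr0_real e0; move: e0; rewrite -(RRe_real h0) ltcR.
set d := complex.Re e => d0.
have [M1 hM1] : exists M, r ^+ M < d / 2 / (C / (1 - r) + 1).
  apply: expr_small hr _; rewrite divr_gt0//; first lra.
  by rewrite ltr_wpDl// divr_ge0//; lra.
have d2 : 0 < d / 2 by lra.
have [M2 hM2] := hs _ d2.
pose M := maxn M1 M2.
(* The first M layers carry the sum up to d / 2, and M makes the tail small. *)
exists [fset j in flatten [seq layer N | N <- iota 0 M]]%fset => J /fsubsetP subJ.
have [L ML hL] : exists2 L, (M <= L)%N & forall j, j \in J -> (deg j < L)%N.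
  (* The sum of the degrees is a crude bound for each of them. *)
  exists (M + (\sum_(j <- J) deg j).+1)%N => [|j jJ]; first exact: leq_addr.
  by rewrite (big_fsetD1 j)//=; set S := (X in (_ + X)%N); lia.
rewrite (layered_partial_sum hL) distrC ltcR.
rewrite -(big_mkord xpredT (fun N => \sum_(j <- layer N | j \in J) f j)).
rewrite (big_cat_nat (n := M))//= big_mkord.
have -> : \sum_(N < M) \sum_(j <- layer N | j \in J) f j = \sum_(N < M) \sum_(j <- layer N) f j.
  apply: eq_bigr => N _; rewrite big_seq_cond [RHS]big_seq; apply: eq_bigl => j.
  case jN: (j \in layer N) => //=; apply: subJ; rewrite inE /=.
  by apply/flattenP; exists (layer N) => //; apply: map_f; rewrite mem_iota /= add0n.
rewrite addrAC; apply: le_lt_trans (le_normcD _ _) _.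
have h1 := hM2 M (leq_maxr _ _).
suff h2 : normc (\sum_(M <= N < L) \sum_(j <- layer N | j \in J) f j) <= C * r ^+ M / (1 - r).
  have h3 : C * r ^+ M / (1 - r) <= d / 2.
    apply: (@le_trans _ _ (C / (1 - r) * r ^+ M1)).
      rewrite mulrAC ler_wpM2l ?divr_ge0//; first lra.
      by apply: ler_wiXn2l; rewrite ?leq_maxl// ltW.
    have : 0 <= C / (1 - r) by rewrite divr_ge0//; lra.
    move: hM1; set D := C / (1 - r) => hM1 D0; have := exprn_ge0 M1 r0.
    by move: hM1; rewrite ltr_pdivlMr; [rewrite mulrDr mulr1 [D * _]mulrC; lra|lra].
  by lra.
apply: le_trans (normc_sum _ _ _) _; apply: le_trans (sum_geometric_lt M L C0 hr).
apply: ler_sum => N _; apply: le_trans (hC N); apply: le_trans (normc_sum _ _ _) _.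
by rewrite [leRHS](bigID (mem J)) /= lerDl sumr_ge0// => j _; exact: normc_ge0.
Qed.

End LayeredSum.

(** * The multiple sum as a chain of nested sums *)

(** The recursion is on the sum M of the tail, so as to match that of nest. *)
Fixpoint compositions (m N : nat) : seq (seq nat) :=
  if m is m'.+1 then
    [seq (N - M)%N :: s | M <- iota 0 N.+1, s <- compositions m' M]
  else [:: [:: N]].

Lemma compositionsS m N : compositions m.+1 N =
  [seq (N - M)%N :: s | M <- iota 0 N.+1, s <- compositions m M].
Proof. by []. Qed.

Lemma mem_compositions m N s :
  (s \in compositions m N) = (size s == m.+1) && (sumn s == N).
Proof.
elim: m N s => [|m IHm] N s.
  by case: s => [|n [|n' s]] //=; rewrite inE eqseq_cons ?andbT ?andbF ?addn0.
rewrite compositionsS; apply/allpairsPdep/andP => [[M [s' [+ + ->]]]|].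
  rewrite mem_iota IHm /= add0n ltnS => MN /andP[/eqP-> /eqP->].
  by rewrite subnK.
case: s => [[]//|n s] [szs /eqP <-]; exists (sumn s), s.
by rewrite mem_iota add0n ltnS leq_addl IHm -eqSS /= addnK eqxx andbT; split.
Qed.

Lemma compositions_uniq m N : uniq (compositions m N).
Proof.
elim: m N => [|m IHm] N //; rewrite compositionsS; apply: allpairs_uniq_dep; rewrite ?iota_uniq//.
move=> _ _ /allpairsPdep[M [s [_ + ->]]] /allpairsPdep[M' [s' [_ + ->]]] /=.
rewrite !mem_compositions => /andP[_ /eqP sM] /andP[_ /eqP sM'] [_ ss'].
by move: sM sM'; rewrite ss' => -> ->.
Qed.

Section Summand.
Variables (F : fieldType) (q : F).
Local Notation iq n := (qpoch q q n)^-1.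

(** The product of the weights selected by the list s = (n_1, ..., n_k), the
current N_j being the sum of what remains of s. *)
Fixpoint nested_term (f : nat -> F) (es s : seq nat) : F :=
  if es is e :: es' then
    let M := sumn (behead s) in
    iq (head 0 s)%N * q ^+ (M * (M + e)) * nested_term f es' (behead s)
  else f (head 0 s)%N.

Lemma sum_nested_term f es N :
  \sum_(s <- compositions (size es) N) nested_term f es s = nest q f es N.
Proof.
elim: es N => [|e es IHes] N; first by rewrite big_seq1.
rewrite compositionsS big_allpairs_dep -[iota 0 N.+1]/(index_iota 0 N.+1) big_mkord.
rewrite [RHS]/=; apply: eq_bigr => -[M MN] _.
rewrite -IHes mulr_sumr big_seq [RHS]big_seq.
apply: eq_bigr => s /=; rewrite mem_compositions => /andP[_ /eqP ->].
by ring.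
Qed.

Lemma nested_termE f es s : size s = (size es).+1 ->
  nested_term f es s = \prod_(j < size es) iq (nth 0 s j)%N
    * q ^+ (\sum_(j < size es) sumn (drop j.+1 s) * (sumn (drop j.+1 s) + nth 0 es j))
    * f (nth 0 s (size es)).
Proof.
elim: es s => [|e es IHes] [|n s] //= [szs]; rewrite ?big_ord0 ?mul1r ?expr0 ?mul1r//.
rewrite IHes//= !big_ord_recl /= drop0 exprD.
ring.
Qed.

End Summand.

(** The linear coefficients of the k weights: the factor (q^(2l+1))^(N_j) is
reduced to q^(2 l N_j) by - N_j in the exponent when j <= i. *)
Definition shifts (i k l : nat) := nseq i (2 * l)%N ++ nseq (k - i) (2 * l + 1)%N.

Lemma tail_sumE k (n : k.-tuple nat) j : tail_sum n j.+1 = sumn (drop j n).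
Proof.
rewrite /tail_sum big_add1 /= sumnE [RHS](big_nth 0%N) size_drop size_tuple.
rewrite -{1}[j]add0n big_addn; apply: eq_bigr => m _.
by rewrite nth_drop addnC /entry.
Qed.

Lemma shifts_exponent (k i l : nat) (S : nat -> nat) : (i <= k)%N ->
  (\sum_(j < k) S j * (S j + nth 0 (shifts i k l) j) + \sum_(j < i) S j
   = (2 * l + 1) * (\sum_(j < k) S j) + \sum_(j < k) S j ^ 2)%N.
Proof.
move=> ik; rewrite (big_ord_widen_cond k (fun=> true) S ik) [X in (_ + X)%N]big_mkcond /=.
rewrite big_distrr -!big_split /=; apply: eq_bigr => j _.
rewrite /shifts nth_cat size_nseq !nth_nseq.
case: ltnP => h; first by nia.
by rewrite ltn_sub2r ?(leq_ltn_trans h)//; nia.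
Qed.

(** Formula for a single term, once the negative part of the exponent has been
absorbed into the shifts. *)
Lemma summandE (F : fieldType) (q : F) (i k l : nat) (n : k.-tuple nat) :
  (0 < k)%N -> (i <= k)%N ->
  summand q i l n = q ^+ (sumn n * (sumn n + head 0 (shifts i k l)))%N
                    * nested_term q (seed q l) (behead (shifts i k l)) n.
Proof.
case: k n => // k n _ ik.
have sz : size (shifts i k.+1 l) = k.+1 by rewrite size_cat !size_nseq; lia.
rewrite nested_termE; last by rewrite size_behead sz size_tuple.
rewrite size_behead sz [k.+1.-1]/=.
rewrite /summand; pose S j := sumn (drop j n).
have sumS m : (\sum_(1 <= j < m.+1) tail_sum n j = \sum_(j < m) S j)%N.
  by rewrite big_add1 big_mkord; apply: eq_bigr => j _; rewrite tail_sumE.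
have sumS2 m : (\sum_(1 <= j < m.+1) tail_sum n j ^ 2 = \sum_(j < m) S j ^ 2)%N.
  by rewrite big_add1 big_mkord; apply: eq_bigr => j _; rewrite tail_sumE.
have US : (\sum_(j < i) S j <= \sum_(j < k.+1) S j ^ 2)%N.
  apply: (@leq_trans (\sum_(j < i) S j ^ 2)); first by apply: leq_sum => j _; nia.
  rewrite (big_ord_widen_cond k.+1 (fun=> true) (fun j => S j ^ 2)%N ik).
  by rewrite [leqRHS](bigID (fun j : 'I__ => (j < i)%N)) /= leq_addr.
rewrite /quad_exp sumS sumS2 sumS subzn// -exprnP -exprM -exprD.
have -> : ((2 * l + 1) * \sum_(j < k.+1) S j + (\sum_(j < k.+1) S j ^ 2 - \sum_(j < i) S j)
   = \sum_(j < k.+1) S j * (S j + nth 0 (shifts i k.+1 l) j))%N.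
  by have := shifts_exponent l S ik; lia.
rewrite big_ord_recl exprD /S drop0 nth0.
rewrite big_add1 big_mkord big_ord_recr /= /seed /entry /=.
have -> : (\sum_(j < k) sumn (drop j.+1 n) *
       (sumn (drop j.+1 n) + nth 0 (behead (shifts i k.+1 l)) j)
   = \sum_(j < k) sumn (drop (bump 0 j) n) *
       (sumn (drop (bump 0 j) n) + nth 0 (shifts i k.+1 l) (bump 0 j)))%N.
  by apply: eq_bigr => j _; rewrite nth_behead.
rewrite prodfV invfM invfM; ring.
Qed.

(** * Theta exponents *)

Lemma sqr_bin2 n : (n * n = 2 * 'C(n, 2) + n)%N.
Proof. by elim: n => // n IHn; rewrite binS bin1; nia. Qed.

Section Exponents.
Variables (i k : nat).
Hypothesis ik : (i <= k)%N.

(** With e = 2k - i this is theta(j), with e = i + 1 it is theta(-j), for j >= 0. *)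
Definition theta_nat (e j : nat) := ((2 * k + 1) * 'C(j, 2) + e * j)%N.

Lemma theta_exp_nonneg (j : nat) : theta_exp k i j%:Z = (theta_nat (2 * k - i) j)%:Z.
Proof.
rewrite /theta_exp (_ : _ + _ = (theta_nat (2 * k - i) j)%:Z * 2) ?mulzK//.
by have := sqr_bin2 j; rewrite /theta_nat; move: 'C(_, _) => c; nia.
Qed.

Lemma theta_exp_nonpos (j : nat) : theta_exp k i (- j%:Z) = (theta_nat (i + 1) j)%:Z.
Proof.
rewrite /theta_exp (_ : _ + _ = (theta_nat (i + 1) j)%:Z * 2) ?mulzK//.
by have := sqr_bin2 j; rewrite /theta_nat; move: 'C(_, _) => c; nia.
Qed.

Lemma prefactor_exp_nat (l : nat) : prefactor_exp k i l = (theta_nat (2 * k - i) l)%:Z.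
Proof.
rewrite /prefactor_exp (_ : _ * (_ + _) = ((2 * k%:Z + 1) * ('C(l, 2)%:Z + l%:Z)) * 2); last first.
  by have := sqr_bin2 l; move: 'C(_, _) => c; nia.
by rewrite mulzK// /theta_nat; move: 'C(_, _) => c; nia.
Qed.

(** The exponent gathered by alpha_r along the lattice, for the left one of the two
kernels created by bailey_lower, is theta(l + r) - theta(l). *)
Lemma theta_nat_right (l r : nat) :
  (theta_nat (2 * k - i) l + ('C(r, 2) + l * r) + (k - i) * (r * (r + (2 * l + 1)))
     + i * (r * (r + 2 * l))
  = theta_nat (2 * k - i) (l + r))%N.
Proof.
rewrite /theta_nat bin2D; have := sqr_bin2 r; move: 'C(l, 2) 'C(r, 2) => b c hr.
have -> : (k = i + (k - i))%N by lia.
move: (k - i)%N => m; rewrite addKn.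
have -> : (2 * (i + m) - i = i + 2 * m)%N by lia.
have -> : (m * (r * (r + (2 * l + 1))) = m * (r * r) + m * r * (2 * l + 1))%N by ring.
have -> : (i * (r * (r + 2 * l)) = i * (r * r) + i * r * (2 * l))%N by ring.
rewrite hr; ring.
Qed.

(** Likewise, the right one of the two kernels yields theta(-l-r-1) - theta(l). *)
Lemma theta_nat_left (l r : nat) :
  (theta_nat (2 * k - i) l + ('C(r, 2) + l * r) + (k - i) * (r * (r + (2 * l + 1)))
     + (2 * r + 2 * l + 1) + i * (r.+1 * (r.+1 + 2 * l))
  = theta_nat (i + 1) (l + r).+1)%N.
Proof.
rewrite /theta_nat binS bin1 bin2D; have := sqr_bin2 r; move: 'C(l, 2) 'C(r, 2) => b c hr.
have -> : (k = i + (k - i))%N by lia.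
move: (k - i)%N => m; rewrite addKn.
have -> : (2 * (i + m) - i = i + 2 * m)%N by lia.
have -> : (m * (r * (r + (2 * l + 1))) = m * (r * r) + m * r * (2 * l + 1))%N by ring.
have -> : (i * (r.+1 * (r.+1 + 2 * l)) = i * (r * r) + i * (2 * r + 1 + r.+1 * (2 * l)))%N by ring.
rewrite hr; ring.
Qed.

Lemma theta_termE (F : fieldType) (q : F) e j :
  theta_term (q ^+ (2 * k + 1)) (q ^+ e) j = (-1) ^+ j * q ^+ theta_nat e j.
Proof. by rewrite /theta_term /theta_nat -!exprM -mulrA -exprD. Qed.

End Exponents.

Lemma signed_nest (F : fieldType) (q : F) (q_neq : forall n, 1 - q ^+ n.+1 != 0) i k l L :
  (i <= k)%N ->
  (-1) ^+ l * q ^+ theta_nat k (2 * k - i) l * nest q (seed q l) (shifts i k l) L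
  = \sum_(r < L.+1) theta_term (q ^+ (2 * k + 1)) (q ^+ (2 * k - i)) (l + r)
       * ((qpoch q q (L - r))^-1 * (qpoch q q (L + r + 2 * l))^-1)
  + \sum_(r < L) theta_term (q ^+ (2 * k + 1)) (q ^+ (i + 1)) (l + r).+1
       * ((qpoch q q (L - r.+1))^-1 * (qpoch q q (L + r.+1 + 2 * l))^-1).
Proof.
move=> ik; rewrite nest_bailey// mulrBr !mulr_sumr -sumrN; congr (_ + _).
  apply: eq_bigr => r _; rewrite theta_termE -theta_nat_right// /seed_alpha !exprD; ring.
apply: eq_bigr => r _; rewrite theta_termE -theta_nat_left// /seed_alpha.
have -> : (-1) ^+ (l + r).+1 = - ((-1) ^+ l * (-1) ^+ r) :> F by rewrite exprS exprD mulN1r.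
by rewrite !exprD; ring.
Qed.

(** * Convergence of the multiple sum *)

Section Multisum.
Variables (R : realType) (q : R[i]).
Hypothesis q1 : normc q < 1.
Local Notation iq n := (qpoch q q n)^-1.

Lemma seed_bounded l : exists2 B, 0 <= B & forall n, normc (seed q l n) <= B.
Proof.
have [B B0 hB] := qpoch_inv_bounded q1 q1.
have r0 := normc_ge0 q.
suff [C C0 hC] : exists2 C, 0 <= C & forall n, normc (Defs.ratio q l n) <= C.
  exists (B * B * C); first by rewrite !mulr_ge0.
  by move=> n; rewrite /seed !normcM !ler_pM ?mulr_ge0 ?normc_ge0.
rewrite /Defs.ratio; case: eqP => [_|/eqP l0].
  by exists 1 => // n; case: eqP => _; rewrite ?normc1 ?normc0.
have h n : 1 - normc q <= normc (1 - q ^+ (l + n)).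
  apply: le_trans (normc_sub_ge _ _); rewrite normc1 lerD2l lerN2 normc_exp.
  by case: l l0 => // l' _; rewrite addSn exprS ler_piMr// exprn_ile1// ltW.
exists (normc (1 - q ^+ l) * (1 - normc q)^-1).
  by rewrite mulr_ge0 ?normc_ge0// invr_ge0 subr_ge0 ltW.
move=> n; rewrite normcM normcV ler_wpM2l ?normc_ge0// lef_pV2 ?posrE ?h//.
  by apply: lt_le_trans (h n); rewrite subr_gt0.
by rewrite subr_gt0.
Qed.

Lemma normc_exp_le m n : (m <= n)%N -> normc (q ^+ n) <= normc q ^+ m.
Proof. by move=> mn; rewrite normc_exp ler_wiXn2l ?normc_ge0// ltW. Qed.

(** Each nested sum is dominated by a geometric series because
M (M + e) >= M, so the bound does not depend on N. *)
Lemma nested_term_bounded (f : nat -> R[i]) es B0 : 0 <= B0 -> (forall n, normc (f n) <= B0) ->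
  exists2 B, 0 <= B &
    forall N, \sum_(s <- compositions (size es) N) normc (nested_term q f es s) <= B.
Proof.
move=> B00 hf; elim: es => [|e es [B Bge0 IH]].
  by exists B0 => // N; rewrite big_seq1 hf.
have [D D0 hD] := qpoch_inv_bounded q1 q1.
have hr : 0 <= normc q < 1 by rewrite normc_ge0.
exists (D * B / (1 - normc q)) => [|N]; first by rewrite divr_ge0 ?mulr_ge0// subr_ge0 ltW.
rewrite compositionsS big_allpairs_dep -[iota 0 N.+1]/(index_iota 0 N.+1) big_mkord.
apply: le_trans (sum_geometric_ord N.+1 (mulr_ge0 D0 Bge0) hr).
apply: ler_sum => M _.
apply: (@le_trans _ _ (D * normc q ^+ M *
    \sum_(s <- compositions (size es) M) normc (nested_term q f es s))).
  rewrite mulr_sumr big_seq [leRHS]big_seq; apply: ler_sum => s /=.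
  rewrite mem_compositions => /andP[_ /eqP ->].
  rewrite !normcM ler_wpM2r ?normc_ge0// ler_pM ?normc_ge0//.
  by apply: normc_exp_le; nia.
rewrite mulrAC; apply: ler_wpM2r; first by rewrite exprn_ge0 ?normc_ge0.
by rewrite ler_wpM2l.
Qed.

Lemma nest_bounded (f : nat -> R[i]) es B0 : 0 <= B0 -> (forall n, normc (f n) <= B0) ->
  exists2 B, 0 <= B & forall N, normc (nest q f es N) <= B.
Proof.
move=> B00 hf; have [B Bge0 hB] := nested_term_bounded es B00 hf; exists B => // N.
by rewrite -sum_nested_term; apply: le_trans (normc_sum _ _ _) (hB N).
Qed.

Lemma sum_pmap_insub (V : nmodType) k (s : seq (seq nat)) (G : seq nat -> V) :
  {in s, forall t, size t == k} ->
  \sum_(n <- pmap insub s : seq (k.-tuple nat)) G n = \sum_(t <- s) G t.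
Proof.
move=> hs; rewrite -(big_map val xpredT G); congr bigop.
rewrite pmap_filter; last exact: insubK.
by apply/all_filterP/allP => t /hs /= ht; rewrite insubT.
Qed.

(** The layers are the sets of tuples with a given N_1; absolute convergence comes
from the exponent N_1 (N_1 + e) >= N_1. *)
Lemma multisum_tendsto (i k l : nat) : (0 < k)%N -> (i <= k)%N ->
  tendsto (fun L => \sum_(N < L) q ^+ (N * (N + head 0 (shifts i k l)))%N
                       * nest q (seed q l) (behead (shifts i k l)) N)
    (multisum (fun n : k.-tuple nat => summand q i l n)).
Proof.
case: k => // k _ ik; set es := behead _; set e := head _ _.
have szes : size es = k.
  by rewrite size_behead /shifts size_cat !size_nseq; lia.
have [B0 B00 hB0] := seed_bounded l.
have [B Bge0 hB] := nested_term_bounded es B00 hB0.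
have [B' B'ge0 hB'] := nest_bounded es B00 hB0.
have hr : 0 <= normc q < 1 by rewrite normc_ge0.
pose g N := q ^+ (N * (N + e))%N * nest q (seed q l) es N.
have [S hS] : exists S, tendsto (fun L => \sum_(N < L) g N) S.
  apply: (series_geometric_tendsto (A := g) (C := B') hr) => N.
  rewrite /g normcM mulrC ler_pM ?normc_ge0//.
  by apply: normc_exp_le; nia.
pose layer N : seq (k.+1.-tuple nat) := pmap insub (compositions k N).
have szl N : {in compositions k N, forall t, size t == k.+1}.
  by move=> t; rewrite mem_compositions => /andP[].
rewrite /multisum
  (@layered_sum _ _ _ (fun n : k.+1.-tuple nat => sumn n) layer _ _ B (normc q) S) //.
- by move=> N; apply: pmap_sub_uniq; exact: compositions_uniq.
- by move=> N n; rewrite mem_pmap_sub mem_compositions size_tuple eqxx.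
- move=> N; under eq_bigr do rewrite summandE//.
  rewrite (sum_pmap_insub
    (fun s => normc (q ^+ (sumn s * (sumn s + e))%N * nested_term q (seed q l) es s)) (szl N)).
  apply: (@le_trans _ _ (normc q ^+ N *
    \sum_(s <- compositions k N) normc (nested_term q (seed q l) es s))).
    rewrite mulr_sumr big_seq [leRHS]big_seq; apply: ler_sum => s.
    rewrite mem_compositions => /andP[_ /eqP ->]; rewrite normcM ler_wpM2r ?normc_ge0//.
    by apply: normc_exp_le; nia.
  by rewrite mulrC ler_wpM2r ?exprn_ge0 ?normc_ge0// -szes.
- apply: eq_tendsto hS _ => L; apply: eq_bigr => N _.
  under [RHS]eq_bigr do rewrite summandE//.
  rewrite (sum_pmap_insub
    (fun s => q ^+ (sumn s * (sumn s + e))%N * nested_term q (seed q l) es s) (szl N)).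
  rewrite /g -sum_nested_term szes mulr_sumr big_seq [RHS]big_seq; apply: eq_bigr => s.
  by rewrite mem_compositions => /andP[_ /eqP ->].
Qed.

(** The factor 1/(q)_(L - N_1) that distinguishes the nested sums from the
partial sums of the series tends to 1/(q)_oo. *)
Lemma nest_tendsto (i k l : nat) : (0 < k)%N -> (i <= k)%N ->
  tendsto (nest q (seed q l) (shifts i k l))
    (multisum (fun n : k.-tuple nat => summand q i l n) * (qpoch_inf q q)^-1).
Proof.
move=> k0 ik; have hS := multisum_tendsto l k0 ik.
have -> : shifts i k l = head 0%N (shifts i k l) :: behead (shifts i k l).
  have : size (shifts i k l) = k by rewrite size_cat !size_nseq; lia.
  by case: shifts => //= h; rewrite -h in k0.
move: hS; set es := behead _; set e := head _ _ => hS.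
have [B0 B00 hB0] := seed_bounded l.
have [B' B'ge0 hB'] := nest_bounded es B00 hB0.
have [D D0 hD] := qpoch_inv_bounded q1 q1.
have hr : 0 <= normc q < 1 by rewrite normc_ge0.
have hg N : normc (q ^+ (N * (N + e))%N * nest q (seed q l) es N) <= B' * normc q ^+ N.
  rewrite normcM mulrC ler_pM ?normc_ge0//.
  by apply: normc_exp_le; nia.
have := tannery (b := fun L j => iq (L - j.+1)) (beta := (qpoch_inf q q)^-1)
  hr hg (fun L j => hD _) _ hS.
have lim j : tendsto (fun L => iq (L - j.+1)) (qpoch_inf q q)^-1.
  apply: (tendsto_comp (f := fun L => (L - j.+1)%N) (c := j.+1) _
    (qpoch_inv_tendsto q1 q1)).
  by move=> n; lia.
move=> /(_ lim) h.
have := tendsto_comp (f := succn) (c := 0%N) (fun n => ltac:(lia)) h.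
move/eq_tendsto; apply => L; apply: eq_bigr => N _.
by rewrite subSS mulrAC.
Qed.

End Multisum.

(** * The truncated theta series *)

Lemma tendsto_sum_shift (R : realType) (A : nat -> R[i]) l s :
  tendsto (fun n => \sum_(j < n) A j) s ->
  tendsto (fun n => \sum_(j < n) A (l + j)%N) (s - \sum_(j < l) A j).
Proof.
move=> hs; have := tendsto_comp (f := addn l) (c := 0%N) (fun n => ltac:(lia)) hs.
move/tendstoD => /(_ _ _ (tendsto_cst (- \sum_(j < l) A j)))/eq_tendsto; apply => n.
by rewrite big_split_ord /= addrAC subrr add0r.
Qed.

Lemma truncated_theta_sum (F : fieldType) (q : F) i k l : (i <= k)%N ->
  \sum_(0 <= m < 2 * l) (let j := m%:Z - l%:Z in (-1) ^ j * q ^ theta_exp k i j)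
  = \sum_(j < l) theta_term (q ^+ (2 * k + 1)) (q ^+ (2 * k - i)) j
  + \sum_(j < l) theta_term (q ^+ (2 * k + 1)) (q ^+ (i + 1)) j.+1.
Proof.
move=> ik; rewrite big_mkord mul2n -addnn big_split_ord /= addrC; congr (_ + _).
  apply: eq_bigr => j _; rewrite PoszD addrAC subrr add0r theta_exp_nonneg//.
  by rewrite theta_termE.
(* The index m < l stands for j = m - l < 0; it is listed from j = -1 down. *)
rewrite (reindex_inj rev_ord_inj); apply: eq_bigr => j _ /=; have jl := ltn_ord j.
rewrite (_ : (l - j.+1)%:Z - l%:Z = - j.+1%:Z); last lia.
rewrite theta_exp_nonpos// theta_termE -!exprnP; congr (_ * _).
by rewrite -exprnN -exprVn invrN invr1.
Qed.

Theorem theorem1p2 (R : realType) (i k l : nat) (q : R[i])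
    (hk : (1 <= k)%N) (hik : (i <= k)%N) (hq : `|q| < 1) :
  let D := qpoch_infs
    [:: q ^+ (i + 1); q ^+ (2 * k - i); q ^+ (2 * k + 1)] (q ^+ (2 * k + 1)) in
  1 / D * (\sum_(0 <= m < 2 * l)
             let j := m%:Z - l%:Z in (-1) ^ j * q ^ theta_exp k i j)
  = 1 + (-1) ^ (l%:Z - 1) * q ^ prefactor_exp k i l * qpoch_inf q q / D
        * multisum (fun n : k.-tuple nat => summand q i l n).
Proof.
have q1 : normc q < 1 by rewrite -ltcR.
have pow_lt1 n : normc (q ^+ n.+1) < 1 by rewrite normc_exp exprn_ilt1 ?normc_ge0.
set p := q ^+ (2 * k + 1); set x := q ^+ (2 * k - i); set y := q ^+ (i + 1); move=> D.
have p1 : normc p < 1 by rewrite /p addn1.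
have x1 : normc x < 1 by rewrite /x (_ : 2 * k - i = (2 * k - i).-1.+1)%N//; lia.
have y1 : normc y < 1 by rewrite /y addn1.
have xy : x * y = p by rewrite -exprD; congr (_ ^+ _); lia.
have [s hs] := theta_sum_cvg xy x1 y1 0 x1.
have [t ht] := theta_sum_cvg xy x1 y1 1 y1.
have {}hs : tendsto (fun n => \sum_(j < n) theta_term p x j) s.
  by move/eq_tendsto: hs; apply => n; apply: eq_bigr => j _; rewrite addn0.
have {}ht : tendsto (fun n => \sum_(j < n) theta_term p y j.+1) t.
  by move/eq_tendsto: ht; apply => n; apply: eq_bigr => j _; rewrite addn1.
have DE : D = s + t.
  rewrite (jacobi_triple_product xy x1 y1 hs ht) /D /qpoch_infs !big_cons big_nil.
  by rewrite mulr1 mulrCA mulrA.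
have D0 : D != 0.
  by rewrite DE (jacobi_triple_product xy x1 y1 hs ht) !mulf_neq0 ?qpoch_inf_neq0.
rewrite truncated_theta_sum// -/p -/x -/y prefactor_exp_nat// -exprnP.
set S := multisum _; set Q := qpoch_inf q q; set sx := \sum_(j < l) _; set sy := \sum_(j < l) _.
have Q0 : Q != 0 by exact: qpoch_inf_neq0.
suff main : (-1) ^+ l * q ^+ theta_nat k (2 * k - i) l * S * Q = D - (sx + sy).
  rewrite (_ : (-1) ^ (l%:Z - 1) = - (-1) ^+ l); last first.
    by rewrite expfzDr ?oppr_eq0 ?oner_eq0// -exprnP -exprnN expr1 invrN invr1 mulrN1.
  have -> : sx + sy = D - (D - (sx + sy)) by ring.
  by rewrite -main; field.
have q_neq n : 1 - q ^+ n.+1 != 0 by exact: one_sub_exp_neq0.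
have hx : 0 <= normc x < 1 by rewrite normc_ge0.
have hy : 0 <= normc y < 1 by rewrite normc_ge0.
have bx n : normc (theta_term p x (l + n)) <= 1 * normc x ^+ n.
  rewrite mul1r; apply: le_trans (theta_term_bound _ _ (ltW p1)) _.
  by rewrite ler_wiXn2l ?normc_ge0 ?leq_addl// ltW.
have yb n : normc (theta_term p y (l + n).+1) <= 1 * normc y ^+ n.
  rewrite mul1r; apply: le_trans (theta_term_bound _ _ (ltW p1)) _.
  by rewrite ler_wiXn2l ?normc_ge0 ?ltW//; lia.
have sx_lim := tendsto_sum_shift l hs.
have sy_lim := tendsto_sum_shift (A := fun j => theta_term p y j.+1) l ht.
(* The first sum of signed_nest has L + 1 terms: it is the sum below at L + 1,
   which is why L.-1 appears. *)
have lx := @kernel_tendsto R q _ (fun L j => (L - j.+1)%N) (fun L j => (L.-1 + j + 2 * l)%N) _ _ _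
  hx q1 bx (fun L j => ltac:(lia)) (fun L j => ltac:(lia)) sx_lim.
have ly := @kernel_tendsto R q _ (fun L j => (L - j.+1)%N) (fun L j => (L + j.+1 + 2 * l)%N) _ _ _
  hy q1 yb (fun L j => ltac:(lia)) (fun L j => ltac:(lia)) sy_lim.
have lim1 := tendstoM (tendsto_cst ((-1) ^+ l * q ^+ theta_nat k (2 * k - i) l))
  (nest_tendsto q1 l hk hik).
have lim2 := tendstoD (tendsto_comp (f := succn) (c := 0%N) (fun n => ltac:(lia)) lx) ly.
have := tendsto_uniq lim1 (eq_tendsto lim2 (fun L => esym (signed_nest q_neq l L hik))).
rewrite -/S -/Q -/sx -/sy DE => h.
transitivity ((-1) ^+ l * q ^+ theta_nat k (2 * k - i) l * (S * Q^-1) * Q ^+ 2); first by field.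
by rewrite h; field.
Qed.
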